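(* Let $d\ge 2$ be an integer, and let $b=b(n)\to\infty$ and $k=k(n)\to\infty$ be sequences of positive integers (as $n\to\infty$) with $b\ge k$ and $n/(bk+k^d)\to 0$. There exists no estimator (sequence of estimators) $V_n\in\widetilde{\mathcal{H}}_{d,b}^k$ such that, for all $\varepsilon>0$, the following limit holds: $$\sup_{p\in\mathcal{D}_d}P\left(\|V_n-p\|>3\min_{q\in\widetilde{\mathcal{H}}_{d,b}^k}\|p-q\|+\varepsilon\right)\to 0\quad\text{as } n\to\infty,$$ where $V_n$ is a function of $X_1,\ldots,X_n\overset{iid}{\sim}p$.
   Context: $\mathcal{D}_d$ is the set of all probability densities (with respect to Lebesgue measure) on $[0,1)^d$, and $\|\cdot\|$ is the $L^1$ norm. $[b]=\{1,\ldots,b\}$. $\mathcal{T}_{d,k}$ is the set of probability tensors in $\mathbb{R}^{k\times\cdots\times k}$ ($d$ modes), i.e. tensors with nonnegative entries summing to one. For $i\in[b]$ let $h_{1,b,i}(x)=b\,\mathbf{1}\left(\frac{i-1}{b}\le x<\frac{i}{b}\right)$ on $[0,1)$, and let $\mathcal{H}_{1,b}=\operatorname{Conv}\{h_{1,b,i}: i\in[b]\}$ be the set of one-dimensional histograms with $b$ bins. The product symbol between functions denotes the outer (tensor) product: $\left(\prod_{j=1}^d f_j\right)(x_1,\ldots,x_d)=f_1(x_1)\cdots f_d(x_d)$. The set of Tucker histograms is $$\widetilde{\mathcal{H}}_{d,b}^k=\left\{\sum_{S\in[k]^d}W_S\prod_{i=1}^d f_{i,S_i}\;\middle|\; W\in\mathcal{T}_{d,k},\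 f_{i,j}\in\mathcal{H}_{1,b}\ (i\in[d],\,j\in[k])\right\}.$$ An estimator $V_n\in\widetilde{\mathcal{H}}_{d,b}^k$ is a (measurable) map, not depending on $p$ or $\varepsilon$, from samples $(X_1,\ldots,X_n)\in([0,1)^d)^n$ to $\widetilde{\mathcal{H}}_{d,b(n)}^{k(n)}$; $P$ is the probability over $X_1,\ldots,X_n$ iid with density $p$. *)

(* Defs.v *)
From HB Require Import structures.
From mathcomp Require Import all_boot all_order all_algebra.
From mathcomp Require Import all_classical all_reals all_analysis.
From mathcomp Require Import measurable_realfun.

Set Implicit Arguments.
Unset Strict Implicit.
Unset Printing Implicit Defensive.

Import Order.TTheory GRing.Theory Num.Theory.
Import numFieldNormedType.Exports.

Local Open Scope classical_set_scope.
Local Open Scope ring_scope.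

Section tuple_cons_measure.
Local Open Scope ereal_scope.
Context d (T : measurableType d) (R : realType) (n : nat).

Definition tcons (x : T * n.-tuple T) : n.+1.-tuple T := [tuple of x.1 :: x.2].

Lemma measurable_tcons : measurable_fun [set: T * n.-tuple T] tcons.
Proof. exact: measurable_cons. Qed.

Definition tuple_cons_measure (mu : {sigma_finite_measure set T -> \bar R})
    (nu : {sigma_finite_measure set (n.-tuple T) -> \bar R}) :
    set (n.+1.-tuple T) -> \bar R :=
  pushforward (mu \x nu) tcons.

Variables (mu : {sigma_finite_measure set T -> \bar R})
          (nu : {sigma_finite_measure set (n.-tuple T) -> \bar R}).

Let m := tuple_cons_measure mu nu.

Let m0 : m set0 = 0.
Proof. by rewrite /m /tuple_cons_measure/= /pushforward preimage_set0 measure0. Qed.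

Let m_ge0 A : 0 <= m A.
Proof. exact: integral_ge0. Qed.

Let m_sigma_additive : semi_sigma_additive m.
Proof.
move=> F mF tF mUF; rewrite /m /tuple_cons_measure /pushforward preimage_bigcup.
apply: measure_semi_sigma_additive.
- by move=> k; rewrite -[X in measurable X]setTI; exact: measurable_tcons.
- apply/trivIsetP => /= i j _ _ ij; rewrite -preimage_setI.
  by move/trivIsetP : tF => /(_ _ _ _ _ ij) ->//; rewrite preimage_set0.
- rewrite -preimage_bigcup -[X in measurable X]setTI.
  exact: measurable_tcons.
Qed.

HB.instance Definition _ := isMeasure.Build _ _ _ (tuple_cons_measure mu nu)
  m0 m_ge0 m_sigma_additive.

Lemma tuple_cons_measureE (A : set T) (B : set (n.-tuple T)) :
  measurable A -> measurable B ->
  tuple_cons_measure mu nu [set x : n.+1.-tuple T | A (thead x) /\ B [tuple of behead x]] =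
  mu A * nu B.
Proof.
move=> mA mB; rewrite -product_measure1E//.
rewrite /tuple_cons_measure /pushforward; congr (product_measure1 _ _ _).
have bK (x : T) y : [tuple of behead (tcons (x, y))] = y by exact: val_inj.
by apply/seteqP; split=> -[x y] /=; rewrite bK theadE.
Qed.

Lemma measurable_thead_behead (A : set T) (B : set (n.-tuple T)) :
  measurable A -> measurable B ->
  measurable [set x : n.+1.-tuple T | A (thead x) /\ B [tuple of behead x]].
Proof.
move=> mA mB.
have -> : [set x : n.+1.-tuple T | A (thead x) /\ B [tuple of behead x]] =
  ([set: n.+1.-tuple T] `&` (fun x : n.+1.-tuple T => tnth x ord0) @^-1` A) `&`
  ([set: n.+1.-tuple T] `&` (fun x : n.+1.-tuple T => [tuple of behead x]) @^-1` B).
  by rewrite !setTI.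
apply: measurableI; first exact: measurable_tnth.
exact: measurable_behead.
Qed.

Let m_sigma_finite : sigma_finite setT (tuple_cons_measure mu nu).
Proof.
have /sigma_finiteP[F [TF ndF Foo]] := sigma_finiteT mu.
have /sigma_finiteP[G [TG ndG Goo]] := sigma_finiteT nu.
exists (fun k => [set x : n.+1.-tuple T | F k (thead x) /\ G k [tuple of behead x]]).
  apply/esym/seteqP; split=> // x _.
  have [k _ Fk] : (\bigcup_k F k) (thead x) by rewrite -TF.
  have [l _ Gl] : (\bigcup_k G k) [tuple of behead x] by rewrite -TG.
  exists (maxn k l) => //; split.
    by move: Fk; exact/subsetPset/ndF/leq_maxl.
  by move: Gl; exact/subsetPset/ndG/leq_maxr.
move=> k; have [? ?] := Foo k; have [? ?] := Goo k.
split; first exact: measurable_thead_behead.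
by rewrite tuple_cons_measureE// lte_mul_pinfty// ge0_fin_numE.
Qed.

HB.instance Definition _ := Measure_isSigmaFinite.Build _ _ _
  (tuple_cons_measure mu nu) m_sigma_finite.

End tuple_cons_measure.

(* The n-fold product measure; the 0-fold one is the unit mass at the empty tuple. *)
Fixpoint tuple_measure d (T : measurableType d) (R : realType)
    (mu : {sigma_finite_measure set T -> \bar R}) (n : nat) :
    {sigma_finite_measure set (n.-tuple T) -> \bar R} :=
  match n with
  | 0%N => \d_[tuple]
  | k.+1 => tuple_cons_measure mu (tuple_measure mu k)
  end.

Lemma measurable_tuple_box d (T : measurableType d) n (A : 'I_n -> set T) :
  (forall i, measurable (A i)) ->
  measurable [set x : n.-tuple T | forall i, A i (tnth x i)].
Proof.
move=> mA; rewrite (_ : [set _ | _] =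
    \bigcap_(i in [set: 'I_n])
      ([set: n.-tuple T] `&` (fun x => tnth x i) @^-1` A i)).
  apply: fin_bigcap_measurable => //= i _.
  exact: measurable_tnth.
apply/seteqP; split=> x /=.
- by move=> h i _; split.
- by move=> h i; have [_] := h i I.
Qed.

Lemma tuple_measure_box d (T : measurableType d) (R : realType)
    (mu : {sigma_finite_measure set T -> \bar R}) n (A : 'I_n -> set T) :
  (forall i, measurable (A i)) ->
  tuple_measure mu n [set x | forall i, A i (tnth x i)] =
  (\prod_(i < n) mu (A i))%E.
Proof.
elim: n A => [|n ih] A mA /=.
  by rewrite big_ord0 /dirac indicE mem_set//= => -[].
rewrite big_ord_recl -(ih (fun i => A (lift ord0 i)))//.
rewrite -tuple_cons_measureE//; last first.
  exact: (@measurable_tuple_box _ _ _ (fun i => A (lift ord0 i))).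
congr (tuple_cons_measure _ _ _); apply/seteqP; split=> x /=.
- move=> h; split; first exact: h.
  by move=> i; have := h (lift ord0 i); rewrite {1}(tuple_eta x) tnthS.
- move=> [h0 h] i; have [->|i0] := eqVneq i ord0; first exact: h0.
  case: (unliftP ord0 i) i0 => [j ->|->]; last by rewrite eqxx.
  by move=> _; rewrite (tuple_eta x) tnthS; exact: h.
Qed.

Definition rpoint (R : realType) (d : nat) := d.-tuple (measurableTypeR R).

Definition unit_cube (R : realType) (d : nat) : set (rpoint R d) :=
  [set x | forall i, (0 : R) <= tnth x i < 1].

Definition lebesgue_tuple (R : realType) (d : nat) :
    {sigma_finite_measure set (rpoint R d) -> \bar R} :=
  tuple_measure (@lebesgue_measure R) d.

Lemma measurable_unit_cube (R : realType) d : measurable (@unit_cube R d).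
Proof.
rewrite (_ : @unit_cube R d =
  [set x : rpoint R d | forall i, (`[0%R, 1%R[%classic : set R) (tnth x i)]).
  apply: (@measurable_tuple_box _ (measurableTypeR R) d
    (fun=> `[0%R, 1%R[%classic)) => _.
  exact: measurable_itv.
by apply/seteqP; split=> x /= h i; have := h i; rewrite in_itv.
Qed.

(* Functions on [0,1)^d are represented by functions on R^d. Densities and
   distances only see their values on the cube; histograms vanish off it. *)
Record density (R : realType) (d : nat) := Density {
  pdf :> rpoint R d -> R ;
  pdf_measurable : measurable_fun (@unit_cube R d) pdf ;
  pdf_ge0 : forall x, unit_cube x -> 0 <= pdf x ;
  pdf_integral1 :
    (\int[lebesgue_tuple R d]_(x in @unit_cube R d) (pdf x)%:E = 1)%E }.

Section density_law.
Local Open Scope ereal_scope.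
Context (R : realType) (d : nat) (p : density R d).

Definition density_law (A : set (rpoint R d)) : \bar R :=
  \int[lebesgue_tuple R d]_(x in A `&` @unit_cube R d) (p x)%:E.

Let law0 : density_law set0 = 0.
Proof. by rewrite /density_law set0I integral_set0. Qed.

Let law_ge0 A : 0 <= density_law A.
Proof. by apply: integral_ge0 => x [_ cx]; rewrite lee_fin pdf_ge0. Qed.

Let law_sigma_additive : semi_sigma_additive density_law.
Proof.
move=> /= F mF tF mUF; rewrite /density_law; apply: cvg_toP.
  apply: ereal_nondecreasing_is_cvgn => m n mn.
  by apply: lee_sum_nneg_natr => // k _ _; exact: law_ge0.
rewrite setI_bigcupl ge0_integral_bigcup//=.
- by move=> k; apply: measurableI => //; exact: measurable_unit_cube.
- apply/measurable_EFinP.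
  apply: (measurable_funS (@measurable_unit_cube R d) _ (pdf_measurable p)).
  by move=> x [k _ []].
- by move=> x [k _ [_ cx]]; rewrite lee_fin pdf_ge0.
- exact: trivIset_setIr.
Qed.

HB.instance Definition _ := isMeasure.Build _ _ _ density_law
  law0 law_ge0 law_sigma_additive.

Let law_setT : density_law [set: _] = 1.
Proof. by rewrite /density_law setTI pdf_integral1. Qed.

HB.instance Definition _ := @Measure_isProbability.Build _ _ R density_law
  law_setT.

End density_law.

(* Joint law of X_1, ..., X_n iid with density p. *)
Definition iid_law (R : realType) (d n : nat) (p : density R d) :
    {sigma_finite_measure set (n.-tuple (rpoint R d)) -> \bar R} :=
  tuple_measure (density_law p) n.

Definition L1dist (R : realType) (d : nat) (f g : rpoint R d -> R) : \bar R :=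
  (\int[lebesgue_tuple R d]_(x in @unit_cube R d) (`|f x - g x|%:E))%E.

(* Bins are numbered from 0, hence the shift with respect to i in {1, ..., b}. *)
Definition bin_density (R : realType) (b : nat) (i : 'I_b) (x : R) : R :=
  b%:R * \1_(`[i%:R / b%:R, i.+1%:R / b%:R[%classic : set R) x.

Definition histogram1 (R : realType) (b : nat) : set (R -> R) :=
  [set f | exists w : 'I_b -> R,
    [/\ forall i, 0 <= w i, \sum_(i < b) w i = 1 &
        f = fun x => \sum_(i < b) w i * bin_density i x]].

(* Tensors with d modes of size k, indexed by multi-indices in [k]^d. *)
Definition prob_tensor (R : realType) (d k : nat) :
    set (d.-tuple 'I_k -> R) :=
  [set W | (forall S, 0 <= W S) /\ \sum_(S : d.-tuple 'I_k) W S = 1].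

Definition tucker_histogram (R : realType) (d b k : nat) :
    set (rpoint R d -> R) :=
  [set g | exists W : d.-tuple 'I_k -> R, exists f : 'I_d -> 'I_k -> R -> R,
    [/\ prob_tensor W, forall i j, histogram1 b (f i j) &
        g = fun x => \sum_(S : d.-tuple 'I_k)
              W S * \prod_(i < d) f i (tnth S i) (tnth x i)]].

Definition sample_space (R : realType) (d n : nat) :
    set (n.-tuple (rpoint R d)) :=
  [set X | forall i, unit_cube (tnth X i)].

(* Tucker histograms are determined by their finitely many values on the cells
   of the grid, so measurability of the estimator (for the Borel sigma-algebra
   of the finite-dimensional span) is measurability of each evaluation. *)
Definition is_estimator (R : realType) (d b k n : nat)
    (V : n.-tuple (rpoint R d) -> rpoint R d -> R) : Prop :=
  (forall X, sample_space X -> tucker_histogram b k (V X)) /\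
  (forall y, measurable_fun (@sample_space R d n) (fun X => V X y)).

(* The infimum is attained: the set of Tucker histograms is the image of a
   compact set of parameters under an L1-continuous map. *)
Definition tucker_dist (R : realType) (d b k : nat) (p : rpoint R d -> R) :
    \bar R :=
  ereal_inf [set L1dist p q | q in @tucker_histogram R d b k].

Definition excess_event (R : realType) (d b k n : nat)
    (V : n.-tuple (rpoint R d) -> rpoint R d -> R) (p : density R d) (eps : R) :
    set (n.-tuple (rpoint R d)) :=
  [set X | sample_space X /\
    (3%:E * tucker_dist b k p + eps%:E < L1dist (V X) p)%E].

(* Main.v *)
(* Assouad's argument.  Split the grid into M disjoint pairs of cells and let
   p_s put mass 1/M on the cell of the i-th pair selected by the bit s_i.  On the
   event B_i that no sample falls in the i-th pair, the laws of the sample under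
   p_s and under p_s with its i-th bit flipped coincide, so the estimator errs by
   at least 2/M on that pair for one of the two choices; since
   P(B_i) = (1 - 1/M)^n >= 1 - n/M, averaging over s and summing over i gives an
   expected L1 error of at least 1 - n/M for some s.  The L1 error is at most 2, so
   n/M <= 1/4 prevents it from being small with high probability.

   The p_s are Tucker histograms for two choices of the pairs: (k/2)^d pairs in
   the corner [k]^d of the grid (the tensor W is free), and (b/2)k pairs that
   differ only in the first coordinate, the other coordinates being equal to
   some j in [k] (the b-bin histograms f_{1,j} are free).  As bk + k^d is much
   larger than n, so is at least one of these two numbers. *)
Require Import Defs.
From mathcomp Require Import all_boot all_order all_algebra.
From mathcomp Require Import all_classical all_reals all_analysis.
From mathcomp Require Import measurable_realfun zify lra.

Set Implicit Arguments.
Unset Strict Implicit.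
Unset Printing Implicit Defensive.

Import Order.TTheory GRing.Theory Num.Theory.
Import numFieldNormedType.Exports.

Local Open Scope classical_set_scope.
Local Open Scope ring_scope.

(** * Grid cells and functions constant on them *)

Definition cell (R : realType) d b (c : {ffun 'I_d -> 'I_b}) : set (rpoint R d) :=
  [set x | forall i, (`[(c i)%:R / b%:R, (c i).+1%:R / b%:R[%classic : set R) (tnth x i)].

Arguments cell R {d b} c.

(** [G c] is the mass of the cell [c], not the height over it: each product of bin densities
    integrates to 1. Integrals and L1 distances thus become plain sums over cells. *)
Definition grid_hist (R : realType) d b (G : {ffun 'I_d -> 'I_b} -> R)
    (x : rpoint R d) : R :=
  \sum_c G c * \prod_(i < d) bin_density (c i) (tnth x i).

Lemma measurable_cell (R : realType) d b (c : {ffun 'I_d -> 'I_b}) :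
  measurable (@cell R d b c).
Proof.
apply: (@measurable_tuple_box _ (measurableTypeR R) d
  (fun i => `[(c i)%:R / b%:R, (c i).+1%:R / b%:R[%classic)) => i.
exact: measurable_itv.
Qed.

Lemma lebesgue_cell (R : realType) d b (c : {ffun 'I_d -> 'I_b}) : (0 < b)%N ->
  lebesgue_tuple R d (cell R c) = (b%:R ^- d)%:E.
Proof.
move=> b0.
rewrite (@tuple_measure_box _ (measurableTypeR R) R (@lebesgue_measure R) d
  (fun i => `[(c i)%:R / b%:R, (c i).+1%:R / b%:R[%classic)) //.
rewrite (eq_bigr (fun=> (b%:R^-1 : R)%:E)) => [|i _].
  by rewrite prodEFin prodr_const card_ord exprVn.
have bR : 0 < b%:R :> R by rewrite ltr0n.
apply: etrans (lebesgue_measure_itv _) _; rewrite /= lte_fin ltr_pM2r ?invr_gt0// ltr_nat ltnSn.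
by rewrite -EFinB -mulrBl -natrB// subSnn mul1r.
Qed.

Lemma prod_bin_density (R : realType) d b (c : {ffun 'I_d -> 'I_b})
    (x : rpoint R d) :
  \prod_(i < d) bin_density (c i) (tnth x i) = b%:R ^+ d * \1_(cell R c) x.
Proof.
rewrite /bin_density big_split/= prodr_const card_ord; congr (_ * _).
rewrite indicE; have [/set_mem cx|/negP cx] := boolP (x \in cell R c).
  by rewrite big1// => i _; rewrite indicE mem_set//; exact: cx.
have [i cxi] : exists i,
    ~ (`[(c i)%:R / b%:R, (c i).+1%:R / b%:R[%classic : set R) (tnth x i).
  by apply/existsNP => h; apply: cx; exact: mem_set.
by rewrite (bigD1 i)//= indicE memNset// mul0r.
Qed.

Lemma cell_inj (R : realType) d b (c c' : {ffun 'I_d -> 'I_b}) (x : rpoint R d) :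
  (0 < b)%N -> cell R c x -> cell R c' x -> c = c'.
Proof.
move=> b0 cx c'x; apply/ffunP => i; apply/val_inj/eqP.
have bR : 0 < b%:R :> R by rewrite ltr0n.
have := cx i; have := c'x i; rewrite /= !in_itv/= => /andP[c1 c2] /andP[c3 c4].
have := le_lt_trans c1 c4; have := le_lt_trans c3 c2.
by rewrite !ltr_pM2r ?invr_gt0// !ltr_nat !ltnS eqn_leq => -> ->.
Qed.

Lemma cell_cover (R : realType) d b (x : rpoint R d) :
  (0 < b)%N -> unit_cube x -> exists c : {ffun 'I_d -> 'I_b}, cell R c x.
Proof.
move=> b0 cx.
have bR : 0 < b%:R :> R by rewrite ltr0n.
have trx i : (Num.truncn (tnth x i * b%:R) < b)%N.
  have /andP[x0 x1] := cx i.
  rewrite -(ltr_nat R); apply: le_lt_trans (_ : tnth x i * b%:R < _).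
    by rewrite truncn_le// mulr_ge0// ltW.
  by rewrite gtr_pMl.
exists [ffun i => Ordinal (trx i)] => i /=; rewrite in_itv/= ffunE/=.
have /andP[x0 _] := cx i.
have /truncn_itv/andP[] : 0 <= tnth x i * b%:R by rewrite mulr_ge0// ltW.
by rewrite ler_pdivrMr// ltr_pdivlMr// => -> ->.
Qed.

Lemma cell_unit_cube (R : realType) d b (c : {ffun 'I_d -> 'I_b}) :
  cell R c `<=` @unit_cube R d.
Proof.
move=> x cx i; have := cx i; rewrite /= in_itv/= => /andP[c1 c2].
have bR : 0 < b%:R :> R by rewrite ltr0n (leq_ltn_trans _ (ltn_ord (c i))).
rewrite (le_trans _ c1) ?divr_ge0//= (lt_le_trans c2)//.
by rewrite ler_pdivrMr// mul1r ler_nat.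
Qed.

Lemma grid_histE (R : realType) d b (G : {ffun 'I_d -> 'I_b} -> R)
    (c : {ffun 'I_d -> 'I_b}) (x : rpoint R d) : (0 < b)%N ->
  cell R c x -> grid_hist G x = G c * b%:R ^+ d.
Proof.
move=> b0 cx; rewrite /grid_hist (bigD1 c)//= prod_bin_density indicE mem_set//.
rewrite mulr1 big1 ?addr0// => c' c'c; rewrite prod_bin_density indicE memNset.
  by rewrite !mulr0.
by move=> c'x; move/eqP: c'c; apply; exact: cell_inj c'x cx.
Qed.

Lemma measurable_grid_hist (R : realType) d b (G : {ffun 'I_d -> 'I_b} -> R) D :
  measurable_fun D (grid_hist G).
Proof.
apply: measurable_sum => c; apply: measurable_funM => //.
rewrite (_ : (fun _ => _) = fun x => b%:R ^+ d * \1_(cell R c) x).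
  by apply: measurable_funM => //; apply: measurable_indic; exact: measurable_cell.
by apply/funext => x; exact: prod_bin_density.
Qed.

Lemma grid_hist_ge0 (R : realType) d b (G : {ffun 'I_d -> 'I_b} -> R) x :
  (forall c, 0 <= G c) -> 0 <= grid_hist G x.
Proof.
by move=> G0; apply: sumr_ge0 => c _; rewrite prod_bin_density !mulr_ge0.
Qed.

Lemma integral_grid_hist (R : realType) d b (G : {ffun 'I_d -> 'I_b} -> R) :
  (0 < b)%N -> (forall c, 0 <= G c) ->
  (\int[lebesgue_tuple R d]_(x in @unit_cube R d) (grid_hist G x)%:E =
   (\sum_c G c)%:E)%E.
Proof.
move=> b0 G0.
under eq_integral => x _.
  rewrite /grid_hist; under eq_bigr do rewrite prod_bin_density mulrA.
  rewrite -sumEFin; under eq_bigr do rewrite EFinM.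
  over.
rewrite ge0_integral_sum//=; first last.
- by move=> c x _; rewrite mule_ge0// lee_fin// mulr_ge0// exprn_ge0.
- move=> c; apply: measurable_funeM; apply/measurable_EFinP.
  by apply: measurable_indic; exact: measurable_cell.
- exact: measurable_unit_cube.
rewrite -sumEFin; apply: eq_bigr => c _.
have mD := @measurable_unit_cube R d; have mc := @measurable_cell R d b c.
rewrite ge0_integralZl//; last 2 first.
- by apply/measurable_EFinP; exact: measurable_indic.
- by rewrite lee_fin mulr_ge0.
rewrite integral_indic// setIidl; last exact: cell_unit_cube.
rewrite [X in (_ * X)%E](lebesgue_cell R c b0).
by rewrite -EFinM mulfK// expf_neq0// pnatr_eq0 -lt0n.
Qed.

(** On each cell, the absolute difference of the two functions is the value of the grid histogram
    with masses [|G c - G' c|], whose integral is known. *)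
Lemma L1dist_grid_hist (R : realType) d b (G G' : {ffun 'I_d -> 'I_b} -> R) :
  (0 < b)%N ->
  L1dist (grid_hist G) (grid_hist G') = (\sum_c `|G c - G' c|)%:E.
Proof.
move=> b0; rewrite -(integral_grid_hist b0 (fun c => normr_ge0 (G c - G' c))).
apply: eq_integral => x /set_mem /(cell_cover b0)[c cx].
rewrite !(grid_histE _ b0 cx) -mulrBl normrM.
by rewrite [X in _ * X]ger0_norm// exprn_ge0.
Qed.

(** Expanding the product over coordinates of sums over bins gives a sum over cells; the mass of [c]
    is the mixture over [S] of the products of one-dimensional weights. The same distributivity
    shows that the masses sum to 1. *)
Lemma tucker_histogramP (R : realType) d b k (g : rpoint R d -> R) :
  tucker_histogram b k g ->
  exists G : {ffun 'I_d -> 'I_b} -> R,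
    [/\ forall c, 0 <= G c, \sum_c G c = 1 & g = grid_hist G].
Proof.
move=> [W [f [[W0 W1] hf ->]]].
have hf' (ij : 'I_d * 'I_k) : {w : 'I_b -> R |
    [/\ forall i, 0 <= w i, \sum_(i < b) w i = 1 &
        f ij.1 ij.2 = fun x => \sum_(i < b) w i * bin_density i x]}.
  exact/cid/hf.
pose w i j := sval (hf' (i, j)).
have w0 i j a : 0 <= w i j a by rewrite /w; case: (hf' _) => ? [].
have w1 i j : \sum_a w i j a = 1 by rewrite /w; case: (hf' _) => ? [].
have fE i j : f i j = fun x => \sum_a w i j a * bin_density a x.
  by rewrite /w; case: (hf' _) => ? [].
exists (fun c => \sum_(S : d.-tuple 'I_k) W S * \prod_i w i (tnth S i) (c i)).
split.
- move=> c; apply: sumr_ge0 => S _; rewrite mulr_ge0// prodr_ge0//.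
- rewrite exchange_big/= -[RHS]W1; apply: eq_bigr => S _.
  rewrite -mulr_sumr -(bigA_distr_bigA (fun i => w i (tnth S i))).
  by rewrite big1 ?mulr1 => [|i _]; last exact: w1.
- rewrite funeqE => x; rewrite /grid_hist.
  under [RHS]eq_bigr do rewrite mulr_suml.
  rewrite exchange_big/=; apply: eq_bigr => S _.
  under [RHS]eq_bigr do rewrite -mulrA -big_split/=.
  rewrite -mulr_sumr; congr (_ * _).
  rewrite -(bigA_distr_bigA
    (fun i a => w i (tnth S i) a * bin_density a (tnth x i))).
  by apply: eq_bigr => i _; rewrite fE.
Qed.

(** * Densities constant on cells and the mass of unions of cells *)

Definition grid_density (R : realType) d b (G : {ffun 'I_d -> 'I_b} -> R)
    (b0 : (0 < b)%N) (G0 : forall c, 0 <= G c) (G1 : \sum_c G c = 1) :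
    density R d :=
  Density (@measurable_grid_hist R d b G _)
    (fun x _ => grid_hist_ge0 x G0)
    (etrans (integral_grid_hist b0 G0) (congr1 EFin G1)).

Definition grid_region (R : realType) d b (Q : {set {ffun 'I_d -> 'I_b}}) :
    set (rpoint R d) :=
  [set x | unit_cube x /\ forall c, cell R c x -> c \in Q].
Arguments grid_region R {d b} Q.

Lemma measurable_grid_region (R : realType) d b (Q : {set {ffun 'I_d -> 'I_b}}) :
  measurable (grid_region R Q).
Proof.
rewrite (_ : grid_region R Q = @unit_cube R d `&`
    \bigcap_(c in [set c | c \notin Q]) ~` cell R c).
  apply: measurableI; first exact: measurable_unit_cube.
  apply: fin_bigcap_measurable => // c _.
  by apply: measurableC; exact: measurable_cell.
apply/seteqP; split=> x [cx h]; split=> // c.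
- by move=> /= cQ /h; exact/negP.
- by move=> ccx; apply/negPn/negP => /h; exact.
Qed.

Lemma density_law_grid_region (R : realType) d b (G : {ffun 'I_d -> 'I_b} -> R)
    (b0 : (0 < b)%N) (G0 : forall c, 0 <= G c) (G1 : \sum_c G c = 1)
    (Q : {set {ffun 'I_d -> 'I_b}}) :
  density_law (grid_density b0 G0 G1) (grid_region R Q) =
  (\sum_(c in Q) G c)%:E.
Proof.
(* Setting the masses outside [Q] to zero turns the right-hand side into an integral over the whole
   cube, compared pointwise with the left-hand side. *)
rewrite big_mkcond/= -integral_grid_hist//; last by move=> c; case: ifP.
rewrite /density_law integral_mkcondl; apply: eq_integral => x /set_mem xcube.
have [c cx] := cell_cover b0 xcube.
rewrite /patch (grid_histE _ b0 cx); case: ifPn => [/set_mem[_ /(_ c cx) ->]|xQ].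
  by rewrite /= (grid_histE _ b0 cx).
rewrite ifN ?mul0r//; apply: contra xQ => cQ; apply/mem_set; split=> // c' c'x.
by rewrite (cell_inj b0 c'x cx).
Qed.

(** * Product measures restricted to a product set *)

(** By induction on [n]: the section of [A] at a first coordinate outside [D] is empty, so the outer
    integral runs over [D] only, where [mu] and [nu] agree, and the remaining sections satisfy the
    induction hypothesis. *)
Lemma tuple_measure_agree d (T : measurableType d) (R : realType)
    (mu nu : {sigma_finite_measure set T -> \bar R}) (D : set T) n
    (A : set (n.-tuple T)) :
  measurable D ->
  (forall B, measurable B -> B `<=` D -> mu B = nu B) ->
  measurable A -> A `<=` [set X | forall i, D (tnth X i)] ->
  tuple_measure mu n A = tuple_measure nu n A.
Proof.
move=> mD munu; elim: n A => [//|n ih] A mA AD /=.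
rewrite /tuple_cons_measure /pushforward /product_measure1.
set B := _ @^-1` A.
have mB : measurable B.
  by rewrite /B -[X in measurable X]setTI; exact: measurable_tcons.
have BD x : xsection B x !=set0 -> D x.
  by move=> [X]; rewrite /xsection/= inE => /AD /(_ ord0); rewrite tnth0.
have secD x : xsection B x `<=` [set X | forall i, D (tnth X i)].
  move=> X; rewrite /xsection/= inE => /AD XD i; have := XD (lift ord0 i).
  by rewrite tnthS.
rewrite [LHS](_ : _ = \int[mu]_(x in D) (tuple_measure nu n (xsection B x)))%E.
  rewrite [RHS](_ : _ = \int[nu]_(x in D) (tuple_measure nu n (xsection B x)))%E.
    exact: eq_measure_integral.
  rewrite [RHS]integral_mkcond; apply: eq_integral => x _ /=; rewrite /patch.
  case: ifPn => // /negP xD; rewrite (_ : xsection B x = set0) ?measure0//.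
  apply/eqP/negPn/negP => /set0P/BD/mem_set; exact: xD.
rewrite [RHS]integral_mkcond; apply: eq_integral => x _ /=; rewrite /patch.
case: ifPn => [_|/negP xD].
  by apply: ih => //; exact: measurable_xsection.
rewrite (_ : xsection B x = set0) ?measure0//.
apply/eqP/negPn/negP => /set0P/BD/mem_set; exact: xD.
Qed.

Lemma tuple_measure_pow d (T : measurableType d) (R : realType)
    (mu : {sigma_finite_measure set T -> \bar R}) (D : set T) n (r : R) :
  measurable D -> mu D = r%:E ->
  tuple_measure mu n [set X | forall i, D (tnth X i)] = (r ^+ n)%:E.
Proof.
move=> mD muD; rewrite (tuple_measure_box mu (fun=> mD)).
by under eq_bigr do rewrite muD; rewrite prodEFin prodr_const card_ord.
Qed.

(** * Elementary inequalities and averaging over the hypercube *)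

Lemma bernoulli_ineq (R : realDomainType) (x : R) n : x <= 1 ->
  1 - n%:R * x <= (1 - x) ^+ n.
Proof.
move=> x1; elim: n => [|n ih]; first by rewrite mul0r subr0.
have [nx|nx] := leP (n%:R * x) 1.
  rewrite exprSr -natr1; apply: le_trans (ler_wpM2r _ ih); last by rewrite subr_ge0.
  rewrite mulrBr mulr1 mulrBl mul1r mulrDl mul1r opprB.
  have : 0 <= n%:R * x * x by rewrite -mulrA mulr_ge0// -expr2 sqr_ge0.
  by lra.
apply: le_trans (exprn_ge0 _ _); last by rewrite subr_ge0.
rewrite subr_le0 (le_trans (ltW nx))//.
have [x0|x0] := leP 0 x; first by rewrite ler_wpM2r// ler_nat.
have := mulr_ge0_le0 (ler0n R n) (ltW x0); lra.
Qed.

Lemma ler_sum_inj (R : numDomainType) (I J : finType) (h : I -> J) (F : J -> R) :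
  injective h -> (forall j, 0 <= F j) -> \sum_i F (h i) <= \sum_j F j.
Proof.
move=> h_inj F0; rewrite [leRHS](bigID (mem (h @: {: I})))/=.
rewrite big_imset/=; last exact: in2W.
by rewrite lerDl sumr_ge0.
Qed.

(** The averaging step of Assouad's argument. Flipping bit [i] is an involution, so summing the
    first hypothesis over [s] counts every [a i s] twice; summing over [i], exchanging the sums and
    dividing by the number of bit vectors gives the bound. *)
Lemma sum_flip_le (R : realFieldType) (I : finType)
    (a : I -> {ffun I -> bool} -> R) (u C : R) :
  (forall i s, u <= a i s + a i [ffun j => s j (+) (j == i)]) ->
  (forall s, \sum_i a i s <= C) -> #|I|%:R * u <= 2 * C.
Proof.
move=> ua aC; set N := #|{: {ffun I -> bool}}|%:R : R.
have N0 : 0 < N by rewrite ltr0n; apply/card_gt0P; exists [ffun=> true].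
have sum_cst (J : finType) (x : R) : #|J|%:R * x = \sum_(j : J) x.
  by rewrite sumr_const mulr_natl.
have half i : N * u <= 2 * \sum_s a i s.
  have flipK : involutive (fun s : {ffun I -> bool} => [ffun j => s j (+) (j == i)]).
    by move=> s; apply/ffunP => j; rewrite !ffunE addbK.
  rewrite mulr2n mulrDl mul1r [X in _ + X](reindex_inj (inv_inj flipK))/=.
  rewrite -big_split/= sum_cst.
  by apply: ler_sum => s _; exact: ua.
rewrite -(ler_pM2l N0) mulrCA sum_cst.
apply: le_trans (ler_sum _ (fun i _ => half i)) _.
rewrite -mulr_sumr mulrCA ler_pM2l// exchange_big/= sum_cst.
by apply: ler_sum => s _; exact: aC.
Qed.

(** * Uniform mixtures and the densities indexed by bit vectors *)

(** The law of [v j] for uniform [j]; a value taken several times accumulates mass. It provides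
    weights on cells, on bins and on tensor indices alike. *)
Definition uniform_law (R : realType) (J T : finType) (v : J -> T) (c : T) : R :=
  \sum_j (c == v j)%:R / #|J|%:R.
Arguments uniform_law R {J T} v c.

Lemma uniform_law_ge0 (R : realType) (J T : finType) (v : J -> T) c :
  0 <= uniform_law R v c.
Proof. by apply: sumr_ge0 => j _; rewrite divr_ge0. Qed.

Lemma sum_uniform_law (R : realType) (J T : finType) (v : J -> T) (F : T -> R) :
  \sum_c uniform_law R v c * F c = \sum_j #|J|%:R^-1 * F (v j).
Proof.
under eq_bigr do rewrite mulr_suml.
rewrite exchange_big/=; apply: eq_bigr => j _.
rewrite (bigD1 (v j))//= eqxx mul1r [X in _ + X]big1 ?addr0// => c /negPf ->.
by rewrite !mul0r.
Qed.

Lemma uniform_law_sum1 (R : realType) (J T : finType) (v : J -> T) :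
  (0 < #|J|)%N -> \sum_c uniform_law R v c = 1.
Proof.
move=> J0; under eq_bigr do rewrite -[uniform_law _ _ _]mulr1.
rewrite sum_uniform_law sumr_const mulr1 -[LHS]mulr_natl mulfV//.
by rewrite pnatr_eq0 -lt0n.
Qed.

(** The cell masses of p_s: [e i false] and [e i true] form the [i]-th pair. The index type [I] is
    left abstract to cover both choices of pairs. *)
Definition pair_weight (R : realType) d b (I : finType)
    (e : I -> bool -> {ffun 'I_d -> 'I_b}) (s : {ffun I -> bool})
    : {ffun 'I_d -> 'I_b} -> R :=
  uniform_law R (fun i => e i (s i)).
Arguments pair_weight R {d b I} e s.

Section pair_weight_theory.
Context (R : realType) d b (I : finType) (e : I -> bool -> {ffun 'I_d -> 'I_b}).
Context (I0 : (0 < #|I|)%N).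
Context (e_inj : forall i j t u, e i t = e j u -> i = j /\ t = u).

Lemma pair_weight_sum1 s : \sum_c pair_weight R e s c = 1.
Proof. exact: uniform_law_sum1. Qed.

Lemma pair_weightE s i t : pair_weight R e s (e i t) = (t == s i)%:R / #|I|%:R.
Proof.
rewrite /pair_weight /uniform_law (bigD1 i)//= big1 ?addr0 => [|j /eqP ji].
  by case: eqP => [/e_inj[_ ->]|h]; [rewrite eqxx|case: eqP => // ti; case: h; rewrite ti].
by case: eqP => [/e_inj[/esym]//|_]; rewrite mul0r.
Qed.

(** Exactly one cell of the [i]-th pair is charged, with mass [1 / #|I|], whatever the bit. *)
Lemma pair_weight_avoid s i :
  \sum_(c in ~: [set e i false; e i true]) pair_weight R e s c =
  1 - #|I|%:R^-1.
Proof.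
apply/eqP; rewrite eq_sym subr_eq; apply/eqP; rewrite -[LHS](pair_weight_sum1 s).
rewrite (bigID (mem (~: [set e i false; e i true])))/=; congr (_ + _).
under eq_bigl do rewrite !inE negbK.
rewrite (bigD1 (e i false)) ?eqxx//= (bigD1 (e i true)) ?eqxx ?orbT//=; last first.
  by apply/eqP => /e_inj[].
rewrite big1 ?addr0 => [|c /andP[/andP[/orP[]/eqP->]]]; rewrite ?eqxx//.
by rewrite !pair_weightE; case: (s i); rewrite ?mul0r ?mul1r ?addr0 ?add0r.
Qed.

Lemma pair_weight_flip (s : {ffun I -> bool}) i c :
  c \in ~: [set e i false; e i true] ->
  pair_weight R e [ffun j => s j (+) (j == i)] c = pair_weight R e s c.
Proof.
rewrite !inE negb_or => /andP[/negPf cf /negPf ct]; apply: eq_bigr => j _.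
rewrite ffunE; have [->|_] := eqVneq j i; last by rewrite addbF.
by case: (s i); rewrite ?cf ?ct.
Qed.

End pair_weight_theory.

(** * Lower bound on the risk for an abstract family of pairs *)

(** Both sides bracket an expected L1 error: Assouad's argument bounds it below by the left-hand
    side for some [s], while an error of at most [eps] outside the excess event and at most 2 on it
    gives the right-hand side. *)
Lemma tucker_lower_bound (R : realType) d b k n (I : finType)
    (e : I -> bool -> {ffun 'I_d -> 'I_b})
    (V : n.-tuple (rpoint R d) -> rpoint R d -> R) (eps delta : R) :
  (0 < b)%N -> (0 < #|I|)%N ->
  (forall i j t u, e i t = e j u -> i = j /\ t = u) ->
  (forall s, tucker_histogram b k (grid_hist (pair_weight R e s))) ->
  is_estimator b k V -> 0 <= eps ->
  (forall p, (iid_law n p (excess_event b k V p eps) <= delta%:E)%E) ->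
  1 - n%:R / #|I|%:R <= eps + 2 * delta.
Proof.
move=> b0 I0 e_inj tuck [VT mV] eps0 Vdelta.
have bd0 : b%:R ^+ d != 0 :> R by rewrite expf_neq0// pnatr_eq0 -lt0n.
set M : R := #|I|%:R.
have M0 : 0 < M by rewrite ltr0n.
pose S := @sample_space R d n.
(* Cells are closed on the left, so they contain their lower corner. Evaluating [V X] there recovers
   the estimated cell masses [Gx X] as measurable functions of the sample. *)
pose corner (c : {ffun 'I_d -> 'I_b}) : rpoint R d :=
  [tuple of [seq (c i)%:R / b%:R | i <- ord_tuple d]].
have corner_cell c : cell R c (corner c).
  move=> i; rewrite /= tnth_map tnth_ord_tuple in_itv/= lexx/=.
  by rewrite ltr_pM2r ?invr_gt0 ?ltr0n// ltr_nat.
pose Gx X c := V X (corner c) / b%:R ^+ d.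
have GxP X : S X ->
    [/\ forall c, 0 <= Gx X c, \sum_c Gx X c = 1 & V X = grid_hist (Gx X)].
  move=> /VT/tucker_histogramP[G [G0 G1 VXE]].
  suff -> : Gx X = G by [].
  by apply/funext => c; rewrite /Gx VXE (grid_histE _ b0 (corner_cell c)) mulfK.
have mS : measurable S.
  apply: (@measurable_tuple_box _ _ n (fun=> @unit_cube R d)) => _.
  exact: measurable_unit_cube.
have mGx c : measurable_fun S (fun X => Gx X c).
  by apply: measurable_funM => //; exact: mV.
pose dens (s : {ffun I -> bool}) := @grid_density R d b (pair_weight R e s) b0 (@uniform_law_ge0 R I _ _)
  (@pair_weight_sum1 R d b I e I0 s).
pose P s := iid_law n (dens s).
pose Z (s : {ffun I -> bool}) X : R := \sum_c `|Gx X c - pair_weight R e s c|.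
(* The error on the two cells of the [i]-th pair if its bit is [t]. *)
pose D i (t : bool) X : R := \sum_(u : bool) `|Gx X (e i u) - (u == t)%:R / M|.
pose Q i := ~: [set e i false; e i true].
pose B i : set (n.-tuple (rpoint R d)) :=
  [set X | forall t, grid_region R (Q i) (tnth X t)].
have Z0 s X : 0 <= Z s X by apply: sumr_ge0.
have D0 i t X : 0 <= D i t X by apply: sumr_ge0.
have mB i : measurable (B i).
  apply: (@measurable_tuple_box _ _ n (fun=> grid_region R (Q i))) => _.
  exact: measurable_grid_region.
have BS i : B i `<=` S by move=> X BX t; have [] := BX t.
have mDS i t : measurable_fun S (EFin \o D i t).
  apply/measurable_EFinP; apply: measurable_sum => u.
  by apply: measurableT_comp => //; apply: measurable_funB.
have mD i t : measurable_fun (B i) (EFin \o D i t).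
  exact: measurable_funS (mDS i t).
have mZ s : measurable_fun S (Z s).
  apply: measurable_sum => c.
  by apply: measurableT_comp => //; apply: measurable_funB.
(* The pairs are disjoint, so their errors add up to part of the total error. *)
have DZ (s : {ffun I -> bool}) X : \sum_i D i (s i) X <= Z s X.
  rewrite /D pair_bigA/= /Z.
  pose F c := `|Gx X c - pair_weight R e s c|.
  rewrite (eq_bigr (fun p => F (e p.1 p.2))) => [|p _]; last first.
    by rewrite /F pair_weightE.
  apply: (@ler_sum_inj _ _ _ (fun p => e p.1 p.2) F); last first.
    by move=> c; exact: normr_ge0.
  by move=> [i t] [j u] /= /e_inj[-> ->].
(* Triangle inequality: the targets [(1/M, 0)] and [(0, 1/M)] are at distance [2/M]. *)
have DD i t X : 2 / M <= D i t X + D i (~~ t) X.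
  rewrite /D !big_bool/=; set g1 := Gx X _; set g2 := Gx X _.
  have := ler_norm (g1 - M^-1); have := ler_norm (- (g1 - M^-1)).
  have := ler_norm (g2 - M^-1); have := ler_norm (- (g2 - M^-1)).
  have := ler_norm g1; have := ler_norm g2.
  have := ler_norm (- g1); have := ler_norm (- g2); rewrite !normrN.
  by clearbody g1 g2 M; case: t; rewrite !eqxx !mul0r !mul1r !subr0; lra.
have law_region (s : {ffun I -> bool}) i :
    density_law (dens s) (grid_region R (Q i)) = (1 - M^-1)%:E.
  by rewrite density_law_grid_region pair_weight_avoid.
have PB s i : P s (B i) = ((1 - M^-1) ^+ n)%:E.
  apply: tuple_measure_pow; first exact: measurable_grid_region.
  exact: law_region.
have PS s : P s S = 1%E.
  rewrite -[in RHS](expr1n R n); apply: tuple_measure_pow.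
    exact: measurable_unit_cube.
  by rewrite /= /density_law setIid; exact: pdf_integral1.
have PP (s : {ffun I -> bool}) i A : measurable A -> A `<=` B i ->
    P [ffun j => s j (+) (j == i)] A = P s A.
  move=> mA AB; apply: tuple_measure_agree mA AB.
    exact: measurable_grid_region.
  move=> C mC CD; apply: eq_integral => x /set_mem[/CD[_ xQ] xcube] /=.
  congr EFin; have [c cx] := cell_cover b0 xcube.
  rewrite !(grid_histE _ b0 cx) pair_weight_flip//.
  exact: xQ.
pose a i (s : {ffun I -> bool}) := (\int[P s]_(X in B i) (D i (s i) X)%:E)%E.
have a0 i s : (0 <= a i s)%E.
  by apply: integral_ge0 => X _; rewrite lee_fin.
have a_flip i s : ((2 / M * (1 - n%:R / M))%:E <=
    a i s + a i [ffun j => s j (+) (j == i)])%E.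
  (* On [B i] the law for the flipped vector is replaced by [P s], so that both errors are
     integrated against the same measure and [DD] applies pointwise. *)
  have -> : a i [ffun j => s j (+) (j == i)] =
      (\int[P s]_(X in B i) (D i (~~ s i) X)%:E)%E.
    rewrite /a ffunE eqxx addbT; apply: eq_measure_integral => A mA AB.
    exact: PP.
  rewrite /a -ge0_integralD//=; first last.
  - exact: mD.
  - by move=> X _; rewrite lee_fin.
  - exact: mD.
  - by move=> X _; rewrite lee_fin.
  apply: (@le_trans _ _ (\int[P s]_(X in B i) (2 / M)%:E)%E); last first.
    apply: ge0_le_integral => //=.
    - by move=> X _; rewrite lee_fin divr_ge0// ltW.
    - by apply: emeasurable_funD; exact: mD.
    - by move=> X _; rewrite -EFinD lee_fin.
  rewrite integral_cst//= [X in (_ * X)%E](PB s i) -EFinM lee_fin.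
  rewrite ler_pM2l ?divr_gt0//; apply: bernoulli_ineq.
  by rewrite invf_le1// ler1n.
have a_sum s : (\sum_i a i s <= (eps + 2 * delta)%:E)%E.
  (* The density is itself a Tucker histogram, so its distance to the class is 0 and the threshold
     reduces to [eps]. *)
  have EE : excess_event b k V (dens s) eps = S `&` [set X | eps < Z s X].
    have -> : excess_event b k V (dens s) eps =
        [set X | S X /\ (eps%:E < L1dist (V X) (dens s))%E].
      rewrite /excess_event (_ : tucker_dist b k (dens s) = 0%E).
        by rewrite mule0 add0e.
      apply/eqP; rewrite eq_le; apply/andP; split; last first.
        apply: le_ereal_inf_tmp => _ [q _ <-]; apply: integral_ge0 => x _.
        by rewrite lee_fin.
      apply: ereal_inf_lbound; exists (dens s); first exact: tuck.
      by apply: integral0_eq => x _; rewrite subrr normr0.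
    apply/seteqP; split=> X [SX]; have [_ _ VE] := GxP X SX.
    - by rewrite VE L1dist_grid_hist// lte_fin.
    - by split=> //; rewrite VE L1dist_grid_hist// lte_fin.
  have mE : measurable (S `&` [set X | eps < Z s X]).
    have /measurable_EFinP mZs := mZ s.
    exact: (emeasurable_fun_o_infty mS mZs eps%:E).
  (* Two probability vectors are at l1 distance at most 2; this bounds the error on the excess
     event. *)
  have Zle X : S X ->
      Z s X <= eps + 2 * \1_(S `&` [set X | eps < Z s X]) X.
    move=> SX; rewrite indicE; case: (boolP (_ \in _)) => [_|/negP XE].
      rewrite mulr1; apply: le_trans (_ : 2 <= _); last by rewrite lerDr.
      have [G0 G1 _] := GxP X SX.
      apply: (@le_trans _ _ (\sum_c (Gx X c + pair_weight R e s c))).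
        apply: ler_sum => c _; rewrite (le_trans (ler_normB _ _))//.
        by rewrite !ger0_norm// uniform_law_ge0.
      by rewrite big_split/= G1 pair_weight_sum1.
    rewrite mulr0 addr0 leNgt; apply/negP => eZ; apply: XE; exact: mem_set.
  apply: (@le_trans _ _ (\int[P s]_(X in S) (Z s X)%:E)%E).
    apply: (@le_trans _ _ (\int[P s]_(X in S) (\sum_i (D i (s i) X)%:E))%E).
      rewrite ge0_integral_sum//; last 2 first.
      - by move=> i; exact: mDS.
      - by move=> i X _; rewrite lee_fin.
      apply: lee_sum => i _; apply: ge0_subset_integral => //.
      - exact: mDS.
      - by move=> X _; rewrite lee_fin.
    apply: ge0_le_integral => //.
    - by move=> X _; apply: sume_ge0 => i _; rewrite lee_fin.
    - by apply: emeasurable_sum => i; exact: mDS.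
    - by apply/measurable_EFinP; exact: mZ.
    - by move=> X _; rewrite sumEFin lee_fin.
  apply: (@le_trans _ _ (\int[P s]_(X in S)
      (eps%:E + 2%:E * (\1_(S `&` [set X | eps < Z s X]) X)%:E))%E).
    have m1 : measurable_fun S
        (fun X => (2%:E * (\1_(S `&` [set X | eps < Z s X]) X)%:E)%E : \bar R).
      apply: measurable_funeM; apply/measurable_EFinP.
      by apply: measurable_indic.
    apply: ge0_le_integral => //.
    - by move=> X _; rewrite lee_fin.
    - by apply/measurable_EFinP; exact: mZ.
    - by apply: emeasurable_funD.
  have m1 : measurable_fun S
      (fun X => (\1_(S `&` [set X | eps < Z s X]) X)%:E : \bar R).
    by apply/measurable_EFinP; apply: measurable_indic.
  rewrite ge0_integralD//; last exact: measurable_funeM.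
  rewrite integral_cst// [X in (_ * X)%E]PS mule1 [leRHS]EFinD; apply: leeD2l.
  rewrite ge0_integralZl//.
  rewrite integral_indic// setIAC setIid EFinM lee_pmul2l//.
  by rewrite -EE; exact: Vdelta.
(* The bound on the sum makes each integral finite, so the averaging inequality can be applied to
   real numbers. *)
have aE i s : a i s = (fine (a i s))%:E.
  rewrite fineK// ge0_fin_numE// (le_lt_trans _ (ltry (eps + 2 * delta)))//.
  apply: le_trans (a_sum s); rewrite (bigD1 i)//= leeDl//.
  by apply: sume_ge0.
have := @sum_flip_le R I (fun i s => fine (a i s)) (2 / M * (1 - n%:R / M))
  (eps + 2 * delta).
rewrite mulrA [#|I|%:R * _]mulrC divfK ?gt_eqF// ler_pM2l//; apply.
- by move=> i s; rewrite -lee_fin EFinD -!aE; exact: a_flip.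
- by move=> s; rewrite -lee_fin -sumEFin; under eq_bigr do rewrite -aE; exact: a_sum.
Qed.

(** * The two families of pairs and their Tucker representations *)

Lemma grid_hist_pair_weight (R : realType) d b (I : finType)
    (e : I -> bool -> {ffun 'I_d -> 'I_b}) (s : {ffun I -> bool}) :
  grid_hist (pair_weight R e s) =
  fun x => \sum_i #|I|%:R^-1 * \prod_(l < d) bin_density (e i (s i) l) (tnth x l).
Proof.
by rewrite funeqE => x; rewrite /grid_hist sum_uniform_law.
Qed.

Lemma histogram1_mean (R : realType) b (A : finType) (a : A -> 'I_b) :
  (0 < #|A|)%N ->
  histogram1 b (fun x : R => \sum_i #|A|%:R^-1 * bin_density (a i) x).
Proof.
move=> A0; exists (uniform_law R a); split.
- exact: uniform_law_ge0.
- exact: uniform_law_sum1.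
- by rewrite funeqE => x; rewrite sum_uniform_law.
Qed.

Lemma histogram1_bin (R : realType) b (i : 'I_b) :
  histogram1 b (bin_density i : R -> R).
Proof.
rewrite (_ : bin_density i =
    fun x : R => \sum_(u : unit) #|{: unit}|%:R^-1 * bin_density i x).
  by apply: histogram1_mean; rewrite card_unit.
by rewrite funeqE => x; rewrite (big_pred1 tt) ?card_unit ?invr1 ?mul1r// => -[].
Qed.

(** The tensor is the law of the multi-index [v j] for uniform [j]. *)
Lemma tucker_mixture (R : realType) d b k (J : finType) (v : J -> 'I_d -> 'I_k)
    (f : 'I_d -> 'I_k -> R -> R) :
  (0 < #|J|)%N -> (forall l j, histogram1 b (f l j)) ->
  tucker_histogram b k (fun x : rpoint R d =>
    \sum_j #|J|%:R^-1 * \prod_(l < d) f l (v j l) (tnth x l)).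
Proof.
move=> J0 hf; pose T j : d.-tuple 'I_k := [tuple v j l | l < d].
exists (uniform_law R T), f; split=> //.
- by split=> [S|]; [exact: uniform_law_ge0|exact: uniform_law_sum1].
- rewrite funeqE => x; rewrite sum_uniform_law; apply: eq_bigr => j _.
  by congr (_ * _); apply: eq_bigr => l _; rewrite tnth_mktuple.
Qed.

Lemma half_bin_proof m (a : 'I_m./2) (t : bool) : (a.*2 + t < m)%N.
Proof.
have := ltn_ord a; have := odd_double_half m; case: t => /=; lia.
Qed.

(** Bins [2a] and [2a + 1] form the pair [a]; rounding [m / 2] down keeps both below [m]. *)
Definition half_bin m (a : 'I_m./2) (t : bool) : 'I_m :=
  Ordinal (half_bin_proof a t).

Lemma half_bin_inj m (a c : 'I_m./2) (t u : bool) :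
  half_bin a t = half_bin c u -> a = c /\ t = u.
Proof.
move=> /(congr1 val)/= E; have tu : t = u.
  by have := congr1 odd E; rewrite !oddD !odd_double !oddb.
split=> //; apply/val_inj; move: E; rewrite tu => /addIn.
by rewrite -!muln2 => /eqP; rewrite eqn_pmul2r// => /eqP.
Qed.

Section hypercubes.
Context (R : realType) (d b k : nat) (hkb : (k <= b)%N).
Context (i0 i1 : 'I_d).

(** The corner is cut into blocks of side 2, one for each [c]. The bit moves only coordinate [i0]
    within the block. *)
Definition core_pair (c : {ffun 'I_d -> 'I_k./2}) (t : bool) : {ffun 'I_d -> 'I_b} :=
  [ffun l => widen_ord hkb (half_bin (c l) (t && (l == i0)))].

Definition factor_pair (p : 'I_b./2 * 'I_k) (t : bool) : {ffun 'I_d -> 'I_b} :=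
  [ffun l => if l == i0 then half_bin p.1 t else widen_ord hkb p.2].

Lemma core_pair_inj c c' t u : core_pair c t = core_pair c' u -> c = c' /\ t = u.
Proof.
move=> E; have El l : half_bin (c l) (t && (l == i0)) = half_bin (c' l) (u && (l == i0)).
  have := congr1 (fun f : {ffun _ -> _} => f l) E; rewrite !ffunE.
  by move=> /(congr1 val) /= ?; exact: val_inj.
split; first by apply/ffunP => l; have [] := half_bin_inj (El l).
by have [_] := half_bin_inj (El i0); rewrite eqxx !andbT.
Qed.

(** Coordinate [i0] reveals the bin pair and the bit, and a second coordinate [i1] reveals [p.2];
    this is where dimension at least 2 enters. *)
Lemma factor_pair_inj p q t u : i1 != i0 ->
  factor_pair p t = factor_pair q u -> p = q /\ t = u.
Proof.
case: p q => [a j] [a' j'] i10 E.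
have := congr1 (fun f : {ffun _ -> _} => f i0) E.
rewrite !ffunE eqxx/= => /half_bin_inj[-> ->].
have := congr1 (fun f : {ffun _ -> _} => f i1) E.
rewrite !ffunE (negPf i10) => /(congr1 val) /= jj'.
by rewrite (val_inj jj').
Qed.

(** Each factor [f l j] is the single bin [j], so the tensor alone encodes [s]. *)
Lemma tucker_core s : (0 < k./2)%N ->
  tucker_histogram b k (grid_hist (pair_weight R core_pair s)).
Proof.
move=> k0; rewrite grid_hist_pair_weight.
pose v (c : {ffun 'I_d -> 'I_k./2}) l := half_bin (c l) (s c && (l == i0)).
pose f (l : 'I_d) (j : 'I_k) : R -> R := bin_density (widen_ord hkb j).
rewrite (_ : (fun _ => _) = (fun x : rpoint R d =>
  \sum_c #|{: {ffun 'I_d -> 'I_k./2}}|%:R^-1 *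
    \prod_(l < d) f l (v c l) (tnth x l))).
  apply: tucker_mixture; first by rewrite card_ffun !card_ord expn_gt0 k0.
  by move=> l j; exact: histogram1_bin.
rewrite funeqE => x; apply: eq_bigr => c _; congr (_ * _).
by apply: eq_bigr => l _; rewrite ffunE.
Qed.

(** Here the tensor is uniform on the diagonal and the factors in coordinate [i0] encode [s]: the
    [j]-th one averages the bins selected by the bits [s (a, j)]. In the other coordinates the
    [j]-th factor is the single bin [j]. *)
Lemma tucker_factor s : (0 < b./2)%N -> (0 < k)%N ->
  tucker_histogram b k (grid_hist (pair_weight R factor_pair s)).
Proof.
move=> b0 k0.
pose f (l : 'I_d) (j : 'I_k) : R -> R := if l == i0
  then fun x => \sum_a #|{: 'I_b./2}|%:R^-1 * bin_density (half_bin a (s (a, j))) x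
  else bin_density (widen_ord hkb j).
have := @tucker_mixture R d b k 'I_k (fun j _ => j) f.
rewrite card_ord => /(_ k0) h.
rewrite grid_hist_pair_weight (_ : (fun _ => _) = (fun x : rpoint R d =>
  \sum_(j < k) k%:R^-1 * \prod_(l < d) f l j (tnth x l))).
  apply: h => l j; rewrite /f; case: ifP => _; last exact: histogram1_bin.
  by apply: histogram1_mean; rewrite card_ord.
rewrite funeqE => x; rewrite card_prod !card_ord natrM invfM.
transitivity (\sum_a \sum_j (b./2)%:R^-1 * k%:R^-1 *
    \prod_(l < d) bin_density (factor_pair (a, j) (s (a, j)) l) (tnth x l)).
  by rewrite pair_bigA/=; apply: eq_bigr => -[a j].
rewrite exchange_big/=; apply: eq_bigr => j _.
rewrite (bigD1 i0)//= /f eqxx card_ord mulr_suml mulr_sumr.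
apply: eq_bigr => a _; rewrite (bigD1 i0)//= ffunE eqxx.
rewrite -!mulrA [RHS]mulrCA; congr (_ * (_ * (_ * (_ * _)))).
by apply: eq_bigr => l /negPf li0; rewrite ffunE li0.
Qed.

End hypercubes.

(** * Comparing the number of pairs with the sample size *)

Lemma leq_half3 m : (1 < m)%N -> (m <= 3 * m./2)%N.
Proof. by case: m => [|[|m]] // _; rewrite -{1}(odd_double_half m.+2); lia. Qed.

Theorem theorem2p4 (R : realType) (d : nat) (b k : nat -> nat)
    (hd : (2 <= d)%N)
    (hb0 : forall n, (0 < b n)%N) (hk0 : forall n, (0 < k n)%N)
    (hb : b n @[n --> \oo] --> \oo)
    (hk : k n @[n --> \oo] --> \oo)
    (hbk : forall n, (k n <= b n)%N)
    (hn : (n%:R / (b n * k n + k n ^ d)%N%:R : R) @[n --> \oo] --> (0 : R)) :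
  ~ exists V : forall n, n.-tuple (rpoint R d) -> rpoint R d -> R,
      (forall n, is_estimator (b n) (k n) (V n)) /\
      (forall eps : R, 0 < eps ->
        ereal_sup [set iid_law n p (excess_event (b n) (k n) (V n) p eps)
                  | p in [set: density R d]]
          @[n --> \oo] --> 0%E).
Proof.
move=> [V [VE Vcvg]].
have d0 : (0 < d)%N by exact: ltnW.
(* Halving [b] and [k] costs at most a factor [3 ^ d], keeping the larger family a factor 2, and
   [n / #|I| <= 1/4] a factor 4. *)
pose c : R := (8 * 3 ^ d)%N%:R.
have c0 : 0 < c by rewrite ltr0n muln_gt0 expn_gt0.
have : \forall n \near \oo, False; last by case=> N _ /(_ N (leqnn N)).
(* With [eps = 1/4] and [delta = 1/8], [eps + 2 * delta] is [1/2], below the [3/4] that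
   [n / #|I| <= 1/4] forces. *)
have risk : \forall n \near \oo,
    (ereal_sup [set iid_law n p (excess_event (b n) (k n) (V n) p 4^-1)
               | p in [set: density R d]] < (8^-1 : R)%:E)%E.
  have e4 : (0 : R) < 4^-1 by rewrite invr_gt0.
  apply: (Vcvg _ e4 [set x | (x < (8^-1 : R)%:E)%E]).
  apply: open_nbhs_nbhs; split; first exact: open_ereal_lt_ereal.
  by rewrite /= lte_fin invr_gt0.
have small : \forall n \near \oo,
    (n%:R / (b n * k n + k n ^ d)%N%:R : R) < c^-1.
  by apply: (@cvgr_lt R nat _ _ _ _ hn); rewrite invr_gt0.
have k2 : \forall n \near \oo, (2 <= k n)%N by move/cvgnyPge: hk; exact.
near=> n.
have kn2 : (2 <= k n)%N by near: n.
have bn2 : (2 <= b n)%N := leq_trans kn2 (hbk n).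
have pairs_total : (b n * k n + k n ^ d <=
    3 ^ d * ((b n)./2 * k n + (k n)./2 ^ d))%N.
  rewrite mulnDr leq_add//.
    rewrite (leq_trans (leq_mul (leq_half3 bn2) (leqnn _)))// -mulnA leq_mul//.
    by rewrite -{1}(expn1 3) leq_pexp2l.
  by rewrite -expnMn leq_exp2r//; exact: leq_half3.
have too_many_pairs (I : finType) (e : I -> bool -> {ffun 'I_d -> 'I_(b n)}) :
    (forall i j t u, e i t = e j u -> i = j /\ t = u) ->
    (forall s, tucker_histogram (b n) (k n) (grid_hist (pair_weight R e s))) ->
    ((b n)./2 * k n + (k n)./2 ^ d <= 2 * #|I|)%N -> False.
  move=> e_inj tuck leI.
  have T0 : (0 < b n * k n + k n ^ d)%N by rewrite addn_gt0 expn_gt0 hk0 orbT.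
  have TI : (b n * k n + k n ^ d <= 2 * 3 ^ d * #|I|)%N.
    by rewrite (leq_trans pairs_total)// mulnAC mulnC leq_mul2r leI orbT.
  have I0 : (0 < #|I|)%N by move: (leq_trans T0 TI); rewrite muln_gt0 => /andP[].
  have nI : n%:R / #|I|%:R <= 4^-1 :> R.
    have : (n%:R / (b n * k n + k n ^ d)%N%:R : R) < c^-1 by near: n.
    rewrite ltr_pdivrMr ?ltr0n// mulrC ltr_pdivlMr// -natrM ltr_nat => nc.
    rewrite ler_pdivrMr ?ltr0n// mulrC ler_pdivlMr// -natrM ler_nat.
    have p3 : (0 < 2 * 3 ^ d)%N by rewrite muln_gt0 expn_gt0.
    rewrite -(leq_pmul2l p3) (leq_trans _ TI)// (leq_trans _ (ltnW nc))//.
    by rewrite mulnCA [(8 * _)%N](_ : _ = 2 * 3 ^ d * 4)%N// mulnAC.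
  have rn : (ereal_sup [set iid_law n p (excess_event (b n) (k n) (V n) p 4^-1)
      | p in [set: density R d]] < (8^-1 : R)%:E)%E by near: n.
  have := @tucker_lower_bound R d (b n) (k n) n I e (V n) 4^-1 8^-1 (hb0 n) I0
    e_inj tuck (VE n).
  have H8 p : (iid_law n p (excess_event (b n) (k n) (V n) p 4^-1) <= (8^-1 : R)%:E)%E.
    by apply: le_trans (ltW rn); apply: ereal_sup_ubound; exists p.
  by rewrite invr_ge0 => /(_ (ler0n R 4) H8); lra.
(* The larger family contains at least half of the sum of the two sizes. *)
have [big|big] := leqP ((b n)./2 * k n) ((k n)./2 ^ d).
- apply: (too_many_pairs _ (core_pair (hbk n) (Ordinal d0))).
  + exact: core_pair_inj.
  + by move=> s; apply: tucker_core; rewrite half_gt0.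
  + by rewrite card_ffun !card_ord mul2n -addnn leq_add2r.
- apply: (too_many_pairs _ (factor_pair (hbk n) (Ordinal d0))).
  + by move=> i j t u; apply: (@factor_pair_inj _ _ _ _ _ (Ordinal hd)).
  + by move=> s; apply: tucker_factor; rewrite ?half_gt0.
  + by rewrite card_prod !card_ord mul2n -addnn leq_add2l ltnW.
Unshelve. all: by end_near. Qed.
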